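(* For every Markoff number $m$, the number $\dfrac{2m}{\sqrt{9m^2-4}+3m}$ is a limit point of $\mathcal{Z}\cap(\tfrac13,\infty)$. Conversely, every limit point of $\mathcal{Z}$ that is larger than $\tfrac13$ is of the form $\dfrac{2m}{\sqrt{9m^2-4}+3m}$ for some Markoff number $m$.
   Context: For a rational number $a/b$ in lowest terms with $b\ge 2$, set $\mathcal{Z}(a/b)=\min_{q\in\mathbb{N},\,0<q<b} q\,\|qa/b\|$, where $\|x\|$ denotes the distance from $x$ to the nearest integer. The $\mathcal{Z}$-spectrum is the set $\mathcal{Z}=\{\mathcal{Z}(a/b): a/b\in\mathbb{Q}\}$; equivalently it is the set of values $\inf_{(x,y)\in\Lambda,\,xy\neq0}|xy|$ as $\Lambda$ ranges over unimodular lattices of $\mathbb{R}^2$ contained in $\sqrt{d}\,\mathbb{Q}^2$ for some positive rational $d$. A Markoff number is a positive integer that occurs as a coordinate of a positive integer solution of $x^2+y^2+z^2=3xyz$. *)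

(* Defs.v *)
From Stdlib Require Import Reals ZArith List Lra.
Open Scope R_scope.

Definition dist_nint (x : R) : R :=
  Rmin (x - IZR (Int_part x)) (IZR (Int_part x) + 1 - x).

Definition min_range (f : nat -> R) (n : nat) : R :=
  fold_left Rmin (map f (seq 2 (n - 1))) (f 1%nat).

Definition Zval (a : Z) (b : nat) : R :=
  min_range (fun q => INR q * dist_nint (INR q * IZR a / INR b)) (b - 1).

Definition Zspectrum (z : R) : Prop :=
  exists (a : Z) (b : nat), (2 <= b)%nat /\ Z.gcd a (Z.of_nat b) = 1%Z /\ z = Zval a b.

Definition markoff (m : Z) : Prop :=
  exists x y z : Z, (0 < x)%Z /\ (0 < y)%Z /\ (0 < z)%Z /\
    (x*x + y*y + z*z = 3*x*y*z)%Z /\ (m = x \/ m = y \/ m = z).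

Definition limit_point (S : R -> Prop) (x : R) : Prop :=
  forall eps : R, 0 < eps -> exists s : R, S s /\ s <> x /\ Rabs (s - x) < eps.

Definition markoff_value (m : Z) : R :=
  2 * IZR m / (sqrt (9 * IZR m ^ 2 - 4) + 3 * IZR m).

(* Main.v *)
(* Say that [p/q] is a Markoff fraction if it is the middle vertex of a triple
   [p1/q1 < p/q < p2/q2] obtained from [0/1 < 1/2 < 1/1] by the two moves that replace it by
   [p1/q1, 3 q1 (p/q) - p2/q2, p/q] or [p/q, 3 q2 (p/q) - p1/q1, p2/q2] (acting on integer
   vectors); then [(q1, q2, q)] is a Markoff triple and every Markoff triple occurs.
   Going down the tree, the half-turn that exchanges infinity and [p/q] gives
   [Z(p/q) = q1 q2 / q].

   Let [Z(a/b) > 1/3] with [0 < a < b].  Follow [a/b] down the tree.  As long as the sum of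
   its determinants with the two outer vertices decreases we can go on; if we never hit
   [a/b], we stop when [a/b] is known to be closer to an outer vertex [p1/q1] than the limit
   of the Markoff fractions adjacent to [p1/q1].  Then [a/b] is, up to reflection, a companion
   [p1/q1 + U_(n-1) / (q1 U_n)], where [U_(n+1) = 3 q1 U_n - U_(n-1)]: otherwise one of the
   two companions around it shows that [Z(a/b) <= 1/3].  A companion has
   [Z = q1 U_(n-1) / U_n].

   In both cases [Z(a/b) = m t] with [m] a Markoff number and [t^2 - 3 m t + 1] very small,
   and [markoff_value m] is [m] times the small root of [t^2 - 3 m t + 1].  Above
   [1/3 + delta] only finitely many [m] occur, hence no other limit points. *)

Require Import Defs.
From Stdlib Require Import Reals ZArith Znumtheory List Lia Lra.

(** * Linear recurrences [x_(n+2) = t x_(n+1) - x_n] and Lucas sequences *)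

Open Scope Z_scope.

(** The recursion advances the initial pair, so that a sequence without its first term is again an
    [lrec] by conversion; inductions along chains rely on this. *)
Fixpoint lrec (t x0 x1 : Z) (n : nat) : Z :=
  match n with
  | O => x0
  | S k => lrec t x1 (t * x1 - x0) k
  end.

(** For [t = 3 q1] these are the [U_n] of the companions, with [U_0 = 0] and [U_1 = 1]. *)
Definition lucas (t : Z) (n : nat) : Z := lrec t 0 1 n.

Lemma lrec_SS t x0 x1 n :
  lrec t x0 x1 (S (S n)) = t * lrec t x0 x1 (S n) - lrec t x0 x1 n.
Proof.
  revert x0 x1; induction n as [|n IH]; intros x0 x1; [reflexivity|].
  exact (IH x1 (t * x1 - x0)).
Qed.

Lemma lrec_shift t x0 x1 k n :
  lrec t x0 x1 (k + n) = lrec t (lrec t x0 x1 k) (lrec t x0 x1 (S k)) n.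
Proof.
  revert x0 x1; induction k as [|k IH]; intros x0 x1; [reflexivity|].
  exact (IH x1 (t * x1 - x0)).
Qed.

Lemma lrec_linear t a b x0 x1 y0 y1 n :
  lrec t (a * x0 + b * y0) (a * x1 + b * y1) n = a * lrec t x0 x1 n + b * lrec t y0 y1 n.
Proof.
  revert x0 x1 y0 y1; induction n as [|n IH]; intros x0 x1 y0 y1; [reflexivity|].
  simpl. rewrite <- IH. f_equal; ring.
Qed.

Lemma lucas_SS t n : lucas t (S (S n)) = t * lucas t (S n) - lucas t n.
Proof. apply lrec_SS. Qed.

Lemma lrec_S t x0 x1 n : lrec t x0 x1 (S n) = lucas t (S n) * x1 - lucas t n * x0.
Proof.
  revert x0 x1; induction n as [|n IH]; intros x0 x1.
  - unfold lucas; cbn [lrec]; ring.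
  - change (lrec t x0 x1 (S (S n))) with (lrec t x1 (t * x1 - x0) (S n)).
    rewrite IH, lucas_SS. ring.
Qed.

Lemma lrec_add t x0 x1 k n :
  lrec t x0 x1 (k + S n) = lucas t (S n) * lrec t x0 x1 (S k) - lucas t n * lrec t x0 x1 k.
Proof. rewrite lrec_shift. apply lrec_S. Qed.

Lemma lrec_back t x0 x1 n :
  x0 = lucas t (S n) * lrec t x0 x1 n - lucas t n * lrec t x0 x1 (S n).
Proof.
  induction n as [|n IH].
  - unfold lucas; cbn [lrec]; ring.
  - rewrite IH at 1. rewrite lrec_SS, lucas_SS. ring.
Qed.

Lemma lrec_back_at t x0 x1 k n :
  lrec t x0 x1 k =
  lucas t (S n) * lrec t x0 x1 (k + n) - lucas t n * lrec t x0 x1 (S (k + n)).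
Proof.
  rewrite <- (Nat.add_succ_r k n), !lrec_shift. apply lrec_back.
Qed.

Lemma lucas_add t k n :
  lucas t (S (k + n)) = lucas t (S k) * lucas t (S n) - lucas t k * lucas t n.
Proof.
  rewrite <- Nat.add_succ_r. unfold lucas at 1. rewrite lrec_add. unfold lucas. ring.
Qed.

Lemma lucas_mono t n : 3 <= t -> 0 <= lucas t n < lucas t (S n).
Proof.
  intros Ht; induction n as [|n IH]; [unfold lucas; cbn [lrec]; lia|].
  rewrite lucas_SS. nia.
Qed.

Lemma lucas_le t k n : 3 <= t -> (k <= n)%nat -> lucas t k <= lucas t n.
Proof.
  intros Ht H; induction H as [|n H IH]; [lia|].
  pose proof (lucas_mono t n Ht). lia.
Qed.

(** The form [x^2 + y^2 - t x y] is invariant under the step [(x, y) -> (y, t y - x)]. *)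
Lemma lucas_norm t n :
  lucas t n * lucas t n + lucas t (S n) * lucas t (S n) - t * lucas t n * lucas t (S n) = 1.
Proof.
  induction n as [|n IH]; [unfold lucas; cbn [lrec]; ring|].
  rewrite <- IH, lucas_SS. ring.
Qed.

Lemma lucas_growth q n : 1 <= q -> 2 * q * lucas (3 * q) n <= lucas (3 * q) (S n).
Proof.
  intros Hq. destruct n as [|n]; [unfold lucas; cbn [lrec]; lia|].
  pose proof (lucas_mono (3 * q) n ltac:(lia)). rewrite lucas_SS. nia.
Qed.

(** Vieta jumping: [x0] and [3 m x1 - x0] are the roots of one quadratic, with product
    [x1^2 + m^2 > 0]. The chain therefore stays positive even when it first descends. *)
Lemma markoff_chain_pos m x0 x1 n :
  0 < x0 -> 0 < x1 -> x0 * x0 + x1 * x1 + m * m = 3 * m * x0 * x1 ->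
  0 < lrec (3 * m) x0 x1 n.
Proof.
  revert x0 x1; induction n as [|n IH]; intros x0 x1 H0 H1 H; [exact H0|].
  cbn [lrec]. apply IH; [lia| |lia].
  assert (x0 * (3 * m * x1 - x0) = x1 * x1 + m * m) by nia.
  nia.
Qed.

(** * The tree of Markoff fractions and their approximation constants *)

(** For [p/q] in lowest terms with [q >= 2] and [d > 0] this is [Z(p/q) >= c / (d q)]. As [y] is not
    bounded by [q], it also makes sense at the integer vertices [0/1] and [1/1]. *)
Definition away (p q c d : Z) : Prop :=
  forall x y, 0 < y -> x * q - p * y <> 0 -> c <= d * (y * Z.abs (x * q - p * y)).

Lemma away_opp p q c d : away p q c d -> away (- p) q c d.
Proof.
  intros H x y Hy Hn.
  replace (Z.abs (x * q - - p * y)) with (Z.abs (- x * q - p * y)) by lia.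
  apply H; lia.
Qed.

(* [p1/q1 < p/q < p2/q2] are the vertices of an ideal triangle whose sides have
   lambda lengths [q1, q2, 3 q1 q2 - q]; the last two fields say that the two parents
   are at least as badly approximable as [p/q] will turn out to be, namely [q1 q2 / q]. *)
Record markoff_node (p1 q1 p q p2 q2 : Z) : Prop := {
  mn_pos1 : 0 < q1;
  mn_pos2 : 0 < q2;
  mn_lt1 : q1 < q;
  mn_lt2 : q2 < q;
  mn_eq : q1 * q1 + q2 * q2 + q * q = 3 * q1 * q2 * q;
  mn_det1 : p * q1 - p1 * q = q2;
  mn_det2 : p2 * q - p * q2 = q1;
  mn_gcd1 : rel_prime q1 q;
  mn_gcd2 : rel_prime q2 q;
  mn_gcd12 : rel_prime q1 q2;
  mn_away1 : away p1 q1 (q1 * q1 * q2) q;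
  mn_away2 : away p2 q2 (q2 * q2 * q1) q }.

Lemma node_mirror p1 q1 p q p2 q2 :
  markoff_node p1 q1 p q p2 q2 -> markoff_node (- p2) q2 (- p) q (- p1) q1.
Proof.
  intros []; constructor; auto using away_opp; try lia.
  now apply rel_prime_sym.
Qed.

Lemma node_root : markoff_node 0 1 1 2 1 1.
Proof.
  constructor; try lia; try apply rel_prime_1; intros x y Hy Hn; nia.
Qed.

Lemma node_det12 p1 q1 p q p2 q2 :
  markoff_node p1 q1 p q p2 q2 -> p2 * q1 - p1 * q2 = 3 * q1 * q2 - q.
Proof.
  intros [? ? ? ? E D1 D2 _ _ _ _ _].
  apply (Z.mul_reg_l _ _ q); [lia|].
  transitivity (q1 * (p2 * q) - q2 * (p1 * q)); [ring|].
  replace (p2 * q) with (q1 + p * q2) by lia.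
  replace (p1 * q) with (p * q1 - q2) by lia.
  lia.
Qed.

(** Modulo [q1] the determinant gives [p1 q = - q2] and the Markoff equation gives [q2^2 + q^2 = 0],
    hence [q^2 (p1^2 + 1) = 0]. This divisibility makes the matrix in [companion_step] integral. *)
Lemma node_square1 p1 q1 p q p2 q2 :
  markoff_node p1 q1 p q p2 q2 -> (q1 | p1 * p1 + 1).
Proof.
  intros [? ? ? ? E D1 D2 G _ _ _ _].
  apply Gauss with q; [|assumption]. apply Gauss with q; [|assumption].
  exists (p * p * q1 - 2 * p * q2 + 3 * q2 * q - q1).
  transitivity ((p1 * q) * (p1 * q) + q * q); [ring|].
  replace (p1 * q) with (p * q1 - q2) by lia. lia.
Qed.

Lemma node_square p1 q1 p q p2 q2 :
  markoff_node p1 q1 p q p2 q2 -> (q | p * p + 1).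
Proof.
  intros [? ? ? ? E D1 D2 G _ _ _ _]. apply rel_prime_sym in G.
  apply Gauss with q1; [|assumption]. apply Gauss with q1; [|assumption].
  exists (p1 * p1 * q + 2 * p1 * q2 + 3 * q1 * q2 - q).
  transitivity ((p * q1) * (p * q1) + q1 * q1); [ring|].
  replace (p * q1) with (p1 * q + q2) by lia. lia.
Qed.

(** All cases use [q1 y = q2 d - q e], where [d] and [e] are the determinants with [p/q] and
    [p2/q2]. For [e > 0] the bound at [p2/q2] suffices; for [e = 0] the product is [k^2 q1 q2]; for
    [e < 0] a half-turn brings in the bound at [p1/q1]. *)
Lemma node_away_right p1 q1 p q p2 q2 x y :
  markoff_node p1 q1 p q p2 q2 -> 0 < y -> 0 < x * q - p * y ->
  q1 * q2 <= y * (x * q - p * y).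
Proof.
  intros HN Hy Hd.
  pose proof (node_square _ _ _ _ _ _ HN) as [l Hl].
  pose proof HN as [P1 P2 L1 L2 E D1 D2 G1 G2 G12 A1 A2].
  set (d := x * q - p * y) in *. set (e := x * q2 - p2 * y).
  assert (R : q1 * y = d * q2 - e * q).
  { unfold d, e. rewrite <- D2. ring. }
  destruct (Z.lt_trichotomy e 0) as [He|[He|He]].
  - (* Between [p/q] and [p2/q2]: the half-turn exchanging infinity and [p/q]
       carries [x/y] to a fraction below [p1/q1], with the two factors of the product
       exchanged. *)
    assert (B := A1 (p * x - l * y) d Hd).
    assert (Ee : (p * x - l * y) * q1 - p1 * d = e).
    { apply (Z.mul_reg_l _ _ q); [lia|].
      transitivity (q2 * d - q1 * y); [|lia].
      transitivity (q1 * (p * (x * q) - (l * q) * y) - (p1 * q) * d); [ring|].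
      replace (l * q) with (p * p + 1) by lia.
      replace (p1 * q) with (p * q1 - q2) by lia.
      unfold d. ring. }
    rewrite Ee in B. specialize (B ltac:(lia)).
    rewrite Z.abs_neq in B by lia.
    assert (q1 * (y * d) = q2 * (d * d) + q * (d * - e)).
    { transitivity (d * (q1 * y)); [ring|]. rewrite R. ring. }
    assert (0 <= q2 * (d * d)) by (clear - P2; nia).
    apply (Z.mul_le_mono_pos_l _ _ q1); lia.
  - assert (Hdiv : (q2 | q1 * y)) by (exists d; lia).
    apply Gauss in Hdiv; [|now apply rel_prime_sym].
    destruct Hdiv as [k Hk]. subst y.
    assert (Hdk : d = k * q1).
    { apply (Z.mul_reg_l _ _ q2); [lia|]. rewrite He in R. lia. }
    rewrite Hdk. assert (1 <= k * k) by (clear - Hy P2; nia).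
    clear - H P1 P2. replace (k * q2 * (k * q1)) with (k * k * (q1 * q2)) by ring. nia.
  - assert (B := A2 x y Hy ltac:(unfold e in He; lia)). fold e in B.
    rewrite Z.abs_eq in B by lia.
    assert (q2 * (y * d) = q1 * (y * y) + q * (y * e)).
    { transitivity (y * (q1 * y + e * q)); [|ring]. rewrite R. ring. }
    assert (0 <= q1 * (y * y)) by (clear - P1; nia).
    apply (Z.mul_le_mono_pos_l _ _ q2); lia.
Qed.

Lemma node_away p1 q1 p q p2 q2 :
  markoff_node p1 q1 p q p2 q2 -> away p q (q1 * q2) 1.
Proof.
  intros HN x y Hy Hn.
  destruct (Z.lt_total 0 (x * q - p * y)) as [H|[H|H]]; [|lia|].
  - pose proof (node_away_right _ _ _ _ _ _ x y HN Hy H). lia.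
  - pose proof (node_away_right _ _ _ _ _ _ (- x) y (node_mirror _ _ _ _ _ _ HN) Hy ltac:(lia)).
    replace (Z.abs (x * q - p * y)) with (- x * q - - p * y) by lia. lia.
Qed.

Lemma rel_prime_linear a b k : rel_prime a b -> rel_prime a (k * a - b).
Proof.
  intros H. apply bezout_rel_prime. apply rel_prime_bezout in H.
  destruct H as [u v H]. apply (Bezout_intro _ _ _ (u + k * v) (- v)). lia.
Qed.

(** The new denominator [q' = 3 q1 q - q2] satisfies [q2 q' = q1^2 + q^2]. Hence the new constant
    [q1 q / q'] is at most [q1 q2 / q], which already bounds [p1/q1] by assumption and [p/q] by
    [node_away]. *)
Lemma node_left p1 q1 p q p2 q2 :
  markoff_node p1 q1 p q p2 q2 ->
  markoff_node p1 q1 (3 * q1 * p - p2) (3 * q1 * q - q2) p q.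
Proof.
  intros HN. pose proof (node_det12 _ _ _ _ _ _ HN) as D12.
  pose proof (node_away _ _ _ _ _ _ HN) as A.
  destruct HN as [P1 P2 L1 L2 E D1 D2 G1 G2 G12 A1 A2].
  assert (K : q2 * (3 * q1 * q - q2) = q1 * q1 + q * q) by lia.
  assert (L : q < 3 * q1 * q - q2) by (assert (q <= q1 * q) by (clear - P1 L1; nia); lia).
  constructor; auto; try lia.
  - transitivity (3 * q1 * (p * q1 - p1 * q) - (p2 * q1 - p1 * q2)); [ring|].
    rewrite D1, D12. ring.
  - replace (3 * q1 * q) with (3 * q * q1) by ring. now apply rel_prime_linear.
  - apply rel_prime_linear. now apply rel_prime_sym.
  - intros x y Hy Hn. specialize (A1 x y Hy Hn).
    set (N := y * Z.abs (x * q1 - p1 * y)) in *.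
    assert (HqN : q * (q1 * q1 * q2) <= q * (q * N)) by (clear - A1 L1 P1; nia).
    assert (0 <= N) by (unfold N; clear - Hy; nia).
    apply (Z.mul_le_mono_pos_l _ _ q2); [lia|].
    rewrite (Z.mul_assoc q2 (3 * q1 * q - q2)), K.
    assert (0 <= q1 * q1 * N) by (clear - P1 H; nia). lia.
  - intros x y Hy Hn. specialize (A x y Hy Hn).
    set (N := y * Z.abs (x * q - p * y)) in *. clearbody N.
    assert (HqN : (3 * q1 * q - q2) * (q1 * q2) <= (3 * q1 * q - q2) * N)
      by (clear - A L L1 P1; nia).
    assert (0 <= q1 * (q1 * q1)) by (clear - P1; nia).
    replace ((3 * q1 * q - q2) * (q1 * q2)) with (q1 * (q1 * q1 + q * q)) in HqN
      by (rewrite <- K; ring).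
    lia.
Qed.

Lemma node_right p1 q1 p q p2 q2 :
  markoff_node p1 q1 p q p2 q2 ->
  markoff_node p q (3 * q2 * p - p1) (3 * q2 * q - q1) p2 q2.
Proof.
  intros HN. apply node_mirror, node_left, node_mirror in HN.
  rewrite !Z.opp_involutive in HN.
  now replace (3 * q2 * p - p1) with (- (3 * q2 * - p - - p1)) by ring.
Qed.

(** * Chains of nodes around a fixed vertex, and its companions *)

Lemma node_chain p1 q1 p q p2 q2 k :
  markoff_node p1 q1 p q p2 q2 ->
  markoff_node p1 q1
    (lrec (3 * q1) p2 p (S k)) (lrec (3 * q1) q2 q (S k))
    (lrec (3 * q1) p2 p k) (lrec (3 * q1) q2 q k).
Proof.
  revert p q p2 q2; induction k as [|k IH]; intros p q p2 q2 HN; [exact HN|].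
  exact (IH _ _ _ _ (node_left _ _ _ _ _ _ HN)).
Qed.

(** The difference of the two sides is a term of the chain started downwards with [q, q2], hence
    positive. Geometrically, the companions of [p1/q1] on its right lie to the left of [p/q]. *)
Lemma node_ratio p1 q1 p q p2 q2 n :
  markoff_node p1 q1 p q p2 q2 ->
  q * lucas (3 * q1) n <= q2 * lucas (3 * q1) (S n).
Proof.
  intros [P1 P2 L1 L2 E _ _ _ _ _ _ _].
  assert (H := markoff_chain_pos q1 q q2 (S n)).
  rewrite lrec_S in H. specialize (H ltac:(lia) P2 ltac:(lia)). lia.
Qed.

(** Positive integers cannot decrease forever. *)
Lemma exists_drop (d : nat -> Z) :
  (forall k, 0 < d k) -> exists k, d k <= d (S k).
Proof.
  intros Hpos.
  enough (H : forall N k, d k <= Z.of_nat N -> exists j, d j <= d (S j)).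
  { apply (H (Z.to_nat (d O)) O). specialize (Hpos O). lia. }
  induction N as [|N IH]; intros k Hk; [specialize (Hpos k); lia|].
  destruct (Z_le_gt_dec (d k) (d (S k))) as [H|H]; [now exists k|].
  apply (IH (S k)). lia.
Qed.

Lemma sign_change (d : nat -> Z) n :
  0 < d O -> d n <= 0 -> exists j, (j < n)%nat /\ 0 < d j /\ d (S j) <= 0.
Proof.
  intros H0; induction n as [|n IH]; intros Hn; [lia|].
  destruct (Z_le_gt_dec (d n) 0) as [H|H].
  - destruct (IH H) as (j & ? & ?). exists j; split; [lia|assumption].
  - exists n; repeat split; lia.
Qed.

(* If [x/y] lies beyond every companion of [p1/q1], it lies beyond some Markoff
   fraction of the chain, because both sequences tend to the same quadratic irrational. *)
Lemma beyond_chain p1 q1 p q p2 q2 x y :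
  markoff_node p1 q1 p q p2 q2 ->
  (forall k, 0 < lrec (3 * q1) y (x * q1 - p1 * y) k) ->
  exists k, 0 < lrec (3 * q1) (x * q2 - p2 * y) (x * q - p * y) (S k).
Proof.
  intros HN Hpos.
  destruct (exists_drop _ Hpos) as [k Hk]. exists k.
  specialize (Hpos k).
  pose proof (node_det12 _ _ _ _ _ _ HN) as D12.
  destruct HN as [P1 P2 L1 L2 E D1 D2 _ _ _ _ _].
  assert (H1 : q1 * (x * q - p * y) = q * (x * q1 - p1 * y) + - q2 * y).
  { transitivity (q * (x * q1) - (p * q1) * y); [ring|].
    replace (p * q1) with (p1 * q + q2) by lia. ring. }
  assert (H0 : q1 * (x * q2 - p2 * y) = q2 * (x * q1 - p1 * y) - (3 * q1 * q2 - q) * y).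
  { transitivity (q2 * (x * q1) - (p2 * q1) * y); [ring|].
    replace (p2 * q1) with (p1 * q2 + (3 * q1 * q2 - q)) by lia. ring. }
  set (d := lrec (3 * q1) y (x * q1 - p1 * y)) in *.
  (* Both sides obey the same recurrence, so the relation [H1] propagates along the chain. Where [d]
     does not decrease, the right side is positive because [q2 < q]. *)
  assert (H : q1 * lrec (3 * q1) (x * q2 - p2 * y) (x * q - p * y) (S k) =
              q * d (S k) + - q2 * d k).
  { unfold d.
    change (lrec (3 * q1) y (x * q1 - p1 * y) (S k)) with
      (lrec (3 * q1) (x * q1 - p1 * y) (3 * q1 * (x * q1 - p1 * y) - y) k).
    change (lrec (3 * q1) (x * q2 - p2 * y) (x * q - p * y) (S k)) with
      (lrec (3 * q1) (x * q - p * y) (3 * q1 * (x * q - p * y) - (x * q2 - p2 * y)) k).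
    rewrite <- lrec_linear, <- H1.
    replace (q * (3 * q1 * (x * q1 - p1 * y) - y) + - q2 * (x * q1 - p1 * y)) with
      (q1 * (3 * q1 * (x * q - p * y) - (x * q2 - p2 * y)))
      by (rewrite Z.mul_sub_distr_l, H0;
          replace (q1 * (3 * q1 * (x * q - p * y))) with
            (3 * q1 * (q1 * (x * q - p * y))) by ring; rewrite H1; ring).
    pose proof (lrec_linear (3 * q1) q1 0 (x * q - p * y)
      (3 * q1 * (x * q - p * y) - (x * q2 - p2 * y)) 0 0 k) as HL.
    rewrite !Z.mul_0_l, !Z.add_0_r in HL. now rewrite HL. }
  assert (q2 * d k < q * d (S k)) by (clear - P2 L2 Hk Hpos; nia).
  clear - H H2 P1. nia.
Qed.

(* [(x, y)] moved back by [k] steps of the hyperbolic matrix of trace [3 q1] that sends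
   infinity to [p1/q1]. *)
Lemma companion_step p1 q1 x y k :
  (q1 | p1 * p1 + 1) ->
  exists x', x' * q1 - p1 * lrec (3 * q1) y (x * q1 - p1 * y) k =
             lrec (3 * q1) y (x * q1 - p1 * y) (S k).
Proof.
  intros [l Hl]. set (d := lrec (3 * q1) y (x * q1 - p1 * y)).
  induction k as [|k [x' IH]]; [now exists x|].
  exists (3 * d (S k) + p1 * x' - l * d k).
  unfold d at 4. rewrite lrec_SS. fold d.
  rewrite <- IH.
  transitivity (3 * q1 * (x' * q1 - p1 * d k) + p1 * p1 * d k - (l * q1) * d k); [ring|].
  rewrite <- Hl. ring.
Qed.

(** This is the bound at [p1/q1] with [q2 / q] weakened to [U_n / U_(n+1)] by [node_ratio]. *)
Lemma node_away1 p1 q1 p q p2 q2 n x y :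
  markoff_node p1 q1 p q p2 q2 -> 0 < y -> x * q1 - p1 * y <> 0 ->
  q1 * q1 * lucas (3 * q1) n <= lucas (3 * q1) (S n) * (y * Z.abs (x * q1 - p1 * y)).
Proof.
  intros HN Hy Hn.
  pose proof (node_ratio _ _ _ _ _ _ n HN) as R.
  destruct HN as [P1 P2 L1 L2 _ _ _ _ _ _ A1 _].
  pose proof (lucas_mono (3 * q1) n ltac:(lia)) as M.
  specialize (A1 x y Hy Hn). set (N := y * Z.abs (x * q1 - p1 * y)) in *. clearbody N.
  set (u := lucas (3 * q1) n) in *. set (u' := lucas (3 * q1) (S n)) in *. clearbody u u'.
  apply (Z.mul_le_mono_pos_l _ _ q); [lia|].
  assert (u' * (q1 * q1 * q2) <= u' * (q * N)) by (clear - A1 M; nia).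
  assert (q1 * q1 * (q * u) <= q1 * q1 * (q2 * u'))
    by (apply Z.mul_le_mono_nonneg_l; [clear; nia|exact R]).
  lia.
Qed.

(* [lrec (3 * q1) y (x * q1 - p1 * y) n] is the determinant of [(x, y)] with the companion
   [(p1 U_n + U_(n-1), q1 U_n)] of [(p1, q1)]. *)
Lemma companion_beyond p1 q1 p q p2 q2 n x y :
  markoff_node p1 q1 p q p2 q2 -> 0 < y -> 0 < x * q - p * y ->
  q1 * q1 * lucas (3 * q1) n <= y * lrec (3 * q1) y (x * q1 - p1 * y) (S n).
Proof.
  intros HN Hy Hh.
  pose proof (node_ratio _ _ _ _ _ _ n HN) as R.
  pose proof (node_away_right _ _ _ _ _ _ x y HN Hy Hh) as A.
  destruct HN as [P1 P2 L1 L2 _ D1 _ _ _ _ _ _].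
  pose proof (lucas_mono (3 * q1) n ltac:(lia)) as M.
  rewrite lrec_S.
  assert (E : q * (x * q1 - p1 * y) = q1 * (x * q - p * y) + q2 * y)
    by (rewrite <- D1; ring).
  set (u := lucas (3 * q1) n) in *. set (u' := lucas (3 * q1) (S n)) in *. clearbody u u'.
  set (d := x * q1 - p1 * y) in *. set (h := x * q - p * y) in *. clearbody d h.
  apply (Z.mul_le_mono_pos_l _ _ q); [lia|].
  replace (q * (y * (u' * d - u * y))) with (y * (u' * (q * d) - u * q * y)) by ring.
  rewrite E.
  (* The first summand is controlled by the bound at [p/q], the second is nonnegative by
     [node_ratio]. *)
  replace (y * (u' * (q1 * h + q2 * y) - u * q * y)) with
    (q1 * u' * (y * h) + (y * y) * (q2 * u' - q * u)) by ring.
  assert (q1 * u' * (q1 * q2) <= q1 * u' * (y * h))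
    by (apply Z.mul_le_mono_nonneg_l; [clear - M P1; nia|exact A]).
  assert (0 <= (y * y) * (q2 * u' - q * u))
    by (apply Z.mul_nonneg_nonneg; [clear; nia|lia]).
  assert (q1 * q1 * (q * u) <= q1 * q1 * (q2 * u'))
    by (apply Z.mul_le_mono_nonneg_l; [clear; nia|exact R]).
  lia.
Qed.

(** The [d k] are the determinants of [(x, y)] with the successive companions. If all are positive,
    [(x, y)] lies beyond some node of the chain and [companion_beyond] applies there. Otherwise [d]
    changes sign after some [j], and [y] and [d (S n)] are both expressed through [d j] and
    [d (S j)]. *)
Lemma companion_lower p1 q1 p q p2 q2 n x y :
  markoff_node p1 q1 p q p2 q2 -> 0 < y ->
  lrec (3 * q1) y (x * q1 - p1 * y) (S n) <> 0 ->
  q1 * q1 * lucas (3 * q1) n <= y * Z.abs (lrec (3 * q1) y (x * q1 - p1 * y) (S n)).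
Proof.
  intros HN Hy Hn.
  pose proof (node_square1 _ _ _ _ _ _ HN) as Hsq.
  pose proof (fun k => companion_step p1 q1 x y k Hsq) as Hstep.
  pose proof (beyond_chain _ _ _ _ _ _ x y HN) as Hbeyond.
  pose proof (fun k => lrec_back (3 * q1) y (x * q1 - p1 * y) k) as Hback.
  set (d := lrec (3 * q1) y (x * q1 - p1 * y)) in *.
  assert (P1 : 0 < q1) by apply HN.
  assert (M : forall k, 0 <= lucas (3 * q1) k < lucas (3 * q1) (S k))
    by (intros k; apply lucas_mono; lia).
  destruct (Classical_Prop.classic (forall k, 0 < d k)) as [Hpos|Hneg].
  - destruct (Hbeyond Hpos) as [k Hk].
    assert (Hk' : 0 < x * lrec (3 * q1) q2 q (S k) - lrec (3 * q1) p2 p (S k) * y).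
    { pose proof (lrec_linear (3 * q1) x (- y) q2 q p2 p (S k)) as HL.
      replace (x * q2 + - y * p2) with (x * q2 - p2 * y) in HL by ring.
      replace (x * q + - y * p) with (x * q - p * y) in HL by ring. lia. }
    pose proof (companion_beyond _ _ _ _ _ _ n x y (node_chain _ _ _ _ _ _ k HN) Hy Hk') as H.
    fold d in H. specialize (Hpos (S n)). now rewrite Z.abs_eq by lia.
  - assert (exists k, d k <= 0) as [k Hk].
    { apply Classical_Prop.NNPP; intros H. apply Hneg; intros k.
      destruct (Z_le_gt_dec (d k) 0); [exfalso; apply H; now exists k|lia]. }
    destruct (sign_change d k ltac:(exact Hy) Hk) as (j & _ & Hj & Hj').
    destruct (Nat.le_gt_cases j n) as [Hjn|Hjn].
    + pose proof (Hback j) as E0.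
      assert (En : d (S n) =
        lucas (3 * q1) (S (n - j)) * d (S j) - lucas (3 * q1) (n - j) * d j).
      { unfold d. rewrite <- lrec_add. f_equal. lia. }
      set (i := (n - j)%nat) in *.
      assert (Ei : n = (j + i)%nat) by lia. clearbody i. subst n.
      destruct (Z.eq_dec (d (S j)) 0) as [Hz|Hz].
      (* Here [p1] is a unit modulo [q1], so [q1] divides [d j]; this supplies the factor [q1^2]. *)
      * destruct (Hstep j) as [x' Hx']. destruct Hsq as [l Hl].
        rewrite Hz in *.
        assert (Hc : d j = q1 * (l * d j - p1 * x')).
        { transitivity ((p1 * p1 + 1) * d j - p1 * (p1 * d j)); [ring|].
          rewrite Hl. replace (p1 * d j) with (x' * q1) by lia. ring. }
        set (c := l * d j - p1 * x') in *. clearbody c.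
        destruct i as [|i]; [rewrite En in Hn; unfold lucas at 2 in Hn; cbn [lrec] in Hn; lia|].
        rewrite Nat.add_succ_r in *. rewrite lucas_add.
        rewrite E0, En.
        pose proof (M j) as Mj. pose proof (M i) as Mi.
        rewrite Hc in *.
        set (a := lucas (3 * q1) j) in *. set (a' := lucas (3 * q1) (S j)) in *.
        set (b := lucas (3 * q1) i) in *. set (b' := lucas (3 * q1) (S i)) in *.
        clearbody a a' b b'. clear - Mj Mi P1 Hj.
        rewrite !Z.mul_0_r, Z.sub_0_r, Z.sub_0_l.
        assert (1 <= c) by nia.
        rewrite Z.abs_neq by nia.
        replace (a' * (q1 * c) * - - (b' * (q1 * c))) with ((c * c) * (q1 * q1 * (a' * b')))
          by ring.
        assert (0 <= a * b) by nia. assert (0 < a' * b') by nia.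
        set (g := a' * b') in *. set (f := a * b) in *. clearbody f g.
        assert (q1 * q1 * (g - f) <= q1 * q1 * g) by nia.
        assert (1 <= c * c) by nia. assert (0 <= q1 * q1 * g) by nia.
        nia.
      (* With [X = d j] and [Y = d (S j)], the product expands into nonnegative terms, and [X (- Y)]
         has coefficient [a' b' + a b], at least [U_(j+i+1) = a' b' - a b]. The pair [(x', X)] has
         determinant [Y] with [p1/q1], so [node_away1] bounds [X (- Y)]. *)
      * destruct (Hstep j) as [x' Hx'].
        assert (B := node_away1 _ _ _ _ _ _ (j + i) x' (d j) HN Hj ltac:(lia)).
        rewrite Hx', lucas_add in B.
        rewrite E0, En. etransitivity; [exact B|].
        pose proof (M j) as Mj. pose proof (M i) as Mi.
        set (a := lucas (3 * q1) j) in *. set (a' := lucas (3 * q1) (S j)) in *.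
        set (b := lucas (3 * q1) i) in *. set (b' := lucas (3 * q1) (S i)) in *.
        clearbody a a' b b'. revert Mj Mi Hj Hj' Hz.
        generalize (d j) (d (S j)). clear. intros X Y Ma Mb HX HY HY0.
        rewrite (Z.abs_neq Y) by lia. rewrite Z.abs_neq by nia.
        assert (0 < X * - Y) by nia.
        assert (0 <= a * b * (X * - Y)) by (apply Z.mul_nonneg_nonneg; nia).
        assert (0 <= a' * b * (X * X)) by (apply Z.mul_nonneg_nonneg; nia).
        assert (0 <= a * b' * (- Y * - Y)) by (apply Z.mul_nonneg_nonneg; nia).
        lia.
    (* The sign change comes after companion [S n]: then [d (S n) >= 1], and
       [y >= U_(j+1) >= U_(n+2) >= 4 q1^2 U_n] is large enough by itself. *)
    + destruct (Nat.le_exists_sub (S n) j Hjn) as (i & Ei & _).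
      rewrite Nat.add_comm in Ei. subst j.
      pose proof (lrec_back_at (3 * q1) y (x * q1 - p1 * y) (S n) i) as En.
      fold d in En.
      pose proof (Hback (S n + i)%nat) as E0.
      pose proof (lucas_growth q1 n ltac:(lia)) as G1.
      pose proof (lucas_growth q1 (S n) ltac:(lia)) as G2.
      pose proof (lucas_le (3 * q1) (S (S n)) (S (S n + i)) ltac:(lia) ltac:(lia)) as G3.
      pose proof (M (S n + i)%nat) as M0. pose proof (M i) as Mi. pose proof (M n) as Mn.
      set (X := d (S n + i)%nat) in *. set (Y := d (S (S n + i))) in *. clearbody X Y.
      set (Z := d (S n)) in *. clearbody Z.
      assert (HZ : 1 <= Z) by (clear - En Mi Hj Hj'; nia).
      assert (Hb : lucas (3 * q1) (S (S n + i)) <= y) by (clear - E0 M0 Hj Hj'; nia).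
      rewrite Z.abs_eq by lia.
      assert (4 * q1 * q1 * lucas (3 * q1) n <= lucas (3 * q1) (S (S n)))
        by (clear - G1 G2 P1; nia).
      assert (0 <= q1 * q1 * lucas (3 * q1) n) by (clear - P1 Mn; nia).
      assert (y <= y * Z) by (clear - HZ Hy; nia).
      lia.
Qed.

(** * Classification of the fractions with constant above [1/3] *)

(* For [a/b] in lowest terms this says [Z(a/b) = r / k]: the range [0 < y < b] may be
   replaced by all [y] with [x b <> a y]. *)
Definition min_is (a b r k : Z) : Prop :=
  (forall x y, 0 < y -> x * b - a * y <> 0 -> r * b <= k * (y * Z.abs (x * b - a * y))) /\
  (exists x y, 0 < y /\ x * b - a * y <> 0 /\ r * b = k * (y * Z.abs (x * b - a * y))).

(* The expression [r^2 + k^2 - 3 m r k] is [- m^2] for a Markoff triple [(m, r, k)], and [1]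
   for a companion, where [r = U_(n-1)] and [k = U_n]. *)
Definition near_root (m r k : Z) : Prop :=
  markoff m /\ 0 < m /\ 0 < r <= k /\
  Z.abs (r * r + k * k - 3 * m * r * k) <= m * m /\
  m * m * Z.abs (r * r + k * k - 3 * m * r * k) <= k * k.

Definition classified (a b : Z) : Prop :=
  exists m r k, near_root m r k /\ min_is a b (m * r) k.

Definition above_third (a b : Z) : Prop :=
  forall x y, 0 < y -> x * b - a * y <> 0 -> b < 3 * (y * Z.abs (x * b - a * y)).

Lemma min_is_opp a b r k : min_is a b r k -> min_is (- a) b r k.
Proof.
  intros [H (x & y & Hy & Hn & E)]; split.
  - intros x' y' Hy' Hn'.
    replace (Z.abs (x' * b - - a * y')) with (Z.abs (- x' * b - a * y')) by lia.
    apply H; lia.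
  - exists (- x), y. replace (Z.abs (- x * b - - a * y)) with (Z.abs (x * b - a * y)) by lia.
    repeat split; lia.
Qed.

Lemma classified_opp a b : classified (- a) b -> classified a b.
Proof.
  intros (m & r & k & Hg & Hm). exists m, r, k; split; [exact Hg|].
  apply min_is_opp in Hm. now rewrite Z.opp_involutive in Hm.
Qed.

Lemma above_third_opp a b : above_third a b -> above_third (- a) b.
Proof.
  intros H x y Hy Hn.
  replace (Z.abs (x * b - - a * y)) with (Z.abs (- x * b - a * y)) by lia.
  apply H; lia.
Qed.

Lemma markoff_node_1 p1 q1 p q p2 q2 : markoff_node p1 q1 p q p2 q2 -> markoff q1.
Proof. intros []. exists q1, q2, q. repeat split; lia. Qed.

(** The quadratic expression equals [- m^2], so the last bound needs [m^2 <= k]. It follows from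
    [m r <= k]: otherwise [k (3 m r - k) = m^2 + r^2] would exceed [2 k^2]. *)
Lemma near_root_triple m r k :
  0 < m -> m <= r -> r < k -> m * m + r * r + k * k = 3 * m * r * k -> near_root m r k.
Proof.
  intros Hm Hr Hk E. unfold near_root.
  replace (r * r + k * k - 3 * m * r * k) with (- (m * m)) by lia.
  rewrite Z.abs_opp, Z.abs_eq by nia.
  assert (K : m * r <= k).
  { destruct (Z_le_gt_dec (m * r) k) as [H|H]; [exact H|exfalso].
    assert (E' : k * (3 * (m * r) - k) = m * m + r * r) by lia.
    assert (r <= m * r) by nia.
    generalize dependent (m * r). intros g. intros. nia. }
  assert (m * m <= k) by nia.
  repeat split; try lia; [|nia].
  exists m, r, k; repeat split; lia.
Qed.

Lemma node_near_root p1 q1 p q p2 q2 :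
  markoff_node p1 q1 p q p2 q2 ->
  exists m r, near_root m r q /\ m * r = q1 * q2.
Proof.
  intros [P1 P2 L1 L2 E _ _ _ _ _ _ _].
  destruct (Z_le_gt_dec q1 q2).
  - exists q1, q2; split; [apply near_root_triple; lia|ring].
  - exists q2, q1; split; [apply near_root_triple; lia|ring].
Qed.

Lemma node_min p1 q1 p q p2 q2 a b :
  markoff_node p1 q1 p q p2 q2 -> 0 < b -> a * q = p * b -> min_is a b (q1 * q2) q.
Proof.
  intros HN Hb Hab. pose proof (node_away _ _ _ _ _ _ HN) as A.
  destruct HN as [P1 P2 L1 L2 E D1 _ _ _ _ _ _].
  assert (Hs : forall x y, q * (x * b - a * y) = b * (x * q - p * y)).
  { intros x y. transitivity (q * x * b - (a * q) * y); [ring|]. rewrite Hab. ring. }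
  assert (SA : forall x y, q * Z.abs (x * b - a * y) = b * Z.abs (x * q - p * y)).
  { intros x y. specialize (Hs x y). nia. }
  split.
  - intros x y Hy Hn. specialize (Hs x y).
    specialize (A x y Hy ltac:(nia)).
    replace (q * (y * Z.abs (x * b - a * y))) with (y * (q * Z.abs (x * b - a * y))) by ring.
    rewrite SA. nia.
  (* The parent [p1/q1] attains the minimum: its determinant with [p/q] is [- q2]. *)
  - exists p1, q1. specialize (Hs p1 q1). specialize (SA p1 q1).
    replace (p1 * q - p * q1) with (- q2) in * by lia.
    repeat split; [lia|nia|].
    replace (q * (q1 * Z.abs (p1 * b - a * q1))) with (q1 * (q * Z.abs (p1 * b - a * q1))) by ring.
    rewrite SA, Z.abs_opp, Z.abs_eq by lia. ring.
Qed.

Lemma lrec_increasing_pos t x0 x1 n : 2 <= t -> 0 < x0 <= x1 -> 0 < lrec t x0 x1 n.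
Proof.
  intros Ht; revert x0 x1; induction n as [|n IH]; intros x0 x1 H; [apply H|].
  cbn [lrec]. apply IH. nia.
Qed.

(** The vanishing determinant says that [a/b] is the companion of index [n + 2]. The lower bound is
    [companion_lower], and the centre [p1/q1] attains it. *)
Lemma companion_min p1 q1 p q p2 q2 n a b :
  markoff_node p1 q1 p q p2 q2 -> 0 < b ->
  lrec (3 * q1) b (a * q1 - p1 * b) (S (S n)) = 0 ->
  min_is a b (q1 * lucas (3 * q1) (S n)) (lucas (3 * q1) (S (S n))).
Proof.
  intros HN Hb Hz. assert (P1 : 0 < q1) by apply HN.
  pose proof (fun x y => companion_lower _ _ _ _ _ _ (S n) x y HN) as LB.
  pose proof (lucas_mono (3 * q1) (S n) ltac:(lia)) as M.
  pose proof (lucas_mono (3 * q1) n ltac:(lia)) as M'.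
  rewrite lrec_S in Hz.
  assert (Hs : forall x y, q1 * lucas (3 * q1) (S (S n)) * (x * b - a * y) =
    b * lrec (3 * q1) y (x * q1 - p1 * y) (S (S n))).
  { intros x y. rewrite lrec_S.
    set (u := lucas (3 * q1) (S n)) in *. set (u' := lucas (3 * q1) (S (S n))) in *.
    transitivity (u' * q1 * b * x - y * (u' * (a * q1 - p1 * b)) - u' * p1 * b * y); [ring|].
    replace (u' * (a * q1 - p1 * b)) with (u * b) by lia. ring. }
  split.
  - intros x y Hy Hn. specialize (Hs x y). specialize (LB x y Hy).
    set (u := lucas (3 * q1) (S n)) in *.
    set (u' := lucas (3 * q1) (S (S n))) in *.
    set (d := lrec (3 * q1) y (x * q1 - p1 * y) (S (S n))) in *.
    clearbody u u' d. set (e := x * b - a * y) in *. clearbody e.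
    assert (SA : q1 * u' * Z.abs e = b * Z.abs d) by (rewrite <- (Z.abs_eq (q1 * u')) by (clear - P1 M; nia);
          rewrite <- Z.abs_mul, Hs, Z.abs_mul, (Z.abs_eq b); lia).
    assert (Hd : d <> 0).
    { intros Hd. apply Hn, (Z.mul_reg_l _ _ (q1 * u')); [clear - P1 M; nia|].
      rewrite Hs, Hd. ring. }
    specialize (LB Hd).
    apply (Z.mul_le_mono_pos_l _ _ q1); [lia|].
    replace (q1 * (u' * (y * Z.abs e))) with (y * (q1 * u' * Z.abs e)) by ring.
    rewrite SA.
    replace (y * (b * Z.abs d)) with (b * (y * Z.abs d)) by ring.
    replace (q1 * (q1 * u * b)) with (b * (q1 * q1 * u)) by ring.
    apply Z.mul_le_mono_nonneg_l; lia.
  - exists p1, q1.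
    set (u := lucas (3 * q1) (S n)) in *.
    set (u' := lucas (3 * q1) (S (S n))) in *.
    replace (p1 * b - a * q1) with (- (a * q1 - p1 * b)) by ring.
    generalize dependent (a * q1 - p1 * b). intros d Hz. clearbody u u'.
    assert (0 < d) by (clear - Hz M M' Hb; nia).
    rewrite Z.abs_opp, Z.abs_eq by lia.
    repeat split; [lia|lia|]. nia.
Qed.

(** Here [d > 0 > d'] are determinants with two consecutive companions. Writing [u_i] for [U_(n+i)],
    the hypotheses become [u2 |d'| < u1 d] and [u3 d < u4 |d'|], so [u2 u3 < u1 u4]; but
    [u2 u3 - u1 u4 = 3 q]. *)
Lemma companion_gap q n b d d' :
  1 <= q -> 0 < d -> d' < 0 ->
  b = lucas (3 * q) (S (S (S n))) * d - lucas (3 * q) (S (S n)) * d' ->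
  b < 3 * (q * lucas (3 * q) (S (S n)) * d) ->
  b < 3 * (q * lucas (3 * q) (S (S (S n))) * - d') -> False.
Proof.
  intros Hq Hd Hd' E H1 H2.
  pose proof (lucas_mono (3 * q) n ltac:(lia)) as M0.
  pose proof (lucas_mono (3 * q) (S n) ltac:(lia)) as M1.
  pose proof (lucas_mono (3 * q) (S (S n)) ltac:(lia)) as M2.
  pose proof (lucas_norm (3 * q) (S n)) as HN.
  pose proof (lucas_SS (3 * q) (S n)) as E3.
  set (u1 := lucas (3 * q) (S n)) in *. set (u2 := lucas (3 * q) (S (S n))) in *.
  set (u3 := lucas (3 * q) (S (S (S n)))) in *. clearbody u1 u2 u3.
  assert (I1 : u2 * - d' < u1 * d) by (subst b; nia).
  assert (I2 : u3 * d < (3 * q * u3 - u2) * - d') by (subst b; nia).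
  assert (J1 : (3 * q * u3 - u2) * (u2 * - d') < (3 * q * u3 - u2) * (u1 * d))
    by (apply Z.mul_lt_mono_pos_l; [nia|exact I1]).
  assert (J2 : u2 * (u3 * d) < u2 * ((3 * q * u3 - u2) * - d'))
    by (apply Z.mul_lt_mono_pos_l; [lia|exact I2]).
  assert (J3 : u2 * u3 * d < (3 * q * u3 - u2) * u1 * d) by lia.
  assert (J4 : u2 * u3 < (3 * q * u3 - u2) * u1) by (clear - J3 Hd; nia).
  nia.
Qed.

(** Since the determinants with [p2/q2] and [p/q] do not decrease, those with the whole chain stay
    positive, and by [beyond_chain] the fraction is not beyond all companions. So it is a companion
    or lies between two consecutive ones, which [companion_gap] excludes. *)
Lemma companion_classified p1 q1 p q p2 q2 a b :
  markoff_node p1 q1 p q p2 q2 -> above_third a b -> 0 < b ->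
  0 < a * q1 - p1 * b -> 0 < p2 * b - a * q2 <= p * b - a * q ->
  classified a b.
Proof.
  intros HN Hg Hb HD HE.
  pose proof (beyond_chain _ _ _ _ _ _ a b HN) as Hbeyond.
  pose proof (fun k => lrec_back (3 * q1) b (a * q1 - p1 * b) k) as Hback.
  assert (P1 : 0 < q1) by apply HN.
  assert (Hc : forall k,
    (p1 * lucas (3 * q1) (S k) + lucas (3 * q1) k) * b - a * (q1 * lucas (3 * q1) (S k)) =
    - lrec (3 * q1) b (a * q1 - p1 * b) (S k)) by (intros k; rewrite lrec_S; ring).
  pose proof (fun n => companion_min p1 q1 p q p2 q2 n a b HN Hb) as Hmin.
  set (d := lrec (3 * q1) b (a * q1 - p1 * b)) in *.
  assert (exists k, d k <= 0) as [k Hk].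
  { apply Classical_Prop.NNPP; intros Hno.
    destruct Hbeyond as [k Hk].
    { intros k. destruct (Z_le_gt_dec (d k) 0); [exfalso; apply Hno; now exists k|lia]. }
    pose proof (lrec_increasing_pos (3 * q1) _ _ (S k) ltac:(lia) HE) as H.
    pose proof (lrec_linear (3 * q1) (-1) 0 (p2 * b - a * q2) (p * b - a * q) 0 0 (S k)) as HL.
    replace (-1 * (p2 * b - a * q2) + 0 * 0) with (a * q2 - p2 * b) in HL by ring.
    replace (-1 * (p * b - a * q) + 0 * 0) with (a * q - p * b) in HL by ring.
    lia. }
  assert (G : forall k, d (S k) <> 0 ->
    b < 3 * (q1 * lucas (3 * q1) (S k) * Z.abs (d (S k)))).
  { intros i Hi. rewrite <- (Z.abs_opp (d (S i))), <- Hc. apply Hg.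
    - pose proof (lucas_mono (3 * q1) i ltac:(lia)). nia.
    - rewrite Hc. lia. }
  destruct (sign_change d k Hb Hk) as (j & _ & Hj & Hj').
  assert (d1 : d 1%nat = a * q1 - p1 * b) by reflexivity.
  assert (d2 : d 2%nat = 3 * q1 * (a * q1 - p1 * b) - b) by reflexivity.
  specialize (G O) as G0. rewrite d1 in G0. specialize (G0 ltac:(lia)).
  unfold lucas in G0; cbn [lrec] in G0.
  (* [j = 0] contradicts [HD]; [j = 1] would make the product at [p1/q1] at most [b / 3], against
     [G0]. *)
  destruct j as [|[|j]]; [lia|lia|].
  destruct (Z.eq_dec (d (S (S (S j)))) 0) as [Hz|Hz].
  - exists q1, (lucas (3 * q1) (S (S j))), (lucas (3 * q1) (S (S (S j)))).
    split; [|now apply Hmin].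
    pose proof (lucas_norm (3 * q1) (S (S j))) as Hn.
    pose proof (lucas_mono (3 * q1) (S j) ltac:(lia)) as M1.
    pose proof (lucas_mono (3 * q1) (S (S j)) ltac:(lia)) as M2.
    pose proof (lucas_le (3 * q1) 2 (S (S (S j))) ltac:(lia) ltac:(lia)) as M3.
    unfold lucas at 1 in M3; cbn [lrec] in M3.
    unfold near_root. rewrite Hn. split; [exact (markoff_node_1 _ _ _ _ _ _ HN)|].
    repeat split; try lia; nia.
  - exfalso.
    apply (companion_gap q1 j b (d (S (S j))) (d (S (S (S j))))); try lia.
    + apply Hback.
    + pose proof (G (S j)) as G1. rewrite Z.abs_eq in G1 by lia. apply G1. lia.
    + pose proof (G (S (S j))) as G1. rewrite Z.abs_neq in G1 by lia. apply G1. lia.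
Qed.

Lemma node_classified N : forall p1 q1 p q p2 q2 a b,
  markoff_node p1 q1 p q p2 q2 -> above_third a b -> 0 < b ->
  0 < a * q1 - p1 * b -> 0 < p2 * b - a * q2 ->
  (a * q1 - p1 * b) + (p2 * b - a * q2) <= Z.of_nat N -> classified a b.
Proof.
  induction N as [|N IH]; intros p1 q1 p q p2 q2 a b HN Hg Hb HD HE HS; [lia|].
  (* Stated for all nodes, so that the right-hand case follows by reflection. *)
  assert (Left : forall p1 q1 p q p2 q2 a,
    markoff_node p1 q1 p q p2 q2 -> above_third a b ->
    0 < a * q1 - p1 * b -> 0 < p2 * b - a * q2 ->
    (a * q1 - p1 * b) + (p2 * b - a * q2) <= Z.of_nat (S N) ->
    0 < p * b - a * q -> classified a b).
  { clear - IH Hb. intros p1 q1 p q p2 q2 a HN Hg HD HE HS HF.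
    destruct (Z_lt_ge_dec (p * b - a * q) (p2 * b - a * q2)) as [H|H].
    - apply (IH _ _ _ _ _ _ a b (node_left _ _ _ _ _ _ HN)); lia || assumption.
    - apply (companion_classified _ _ _ _ _ _ a b HN); lia || assumption. }
  destruct (Z.lt_total 0 (p * b - a * q)) as [HF|[HF|HF]].
  - exact (Left _ _ _ _ _ _ a HN Hg HD HE HS HF).
  - destruct (node_near_root _ _ _ _ _ _ HN) as (m & r & Hmr & E).
    exists m, r, q. split; [exact Hmr|]. rewrite E.
    apply (node_min _ _ _ _ _ _ a b HN); lia.
  - apply classified_opp.
    apply (Left _ _ _ _ _ _ (- a) (node_mirror _ _ _ _ _ _ HN)); try lia.
    now apply above_third_opp.
Qed.

Lemma above_third_classified a b : above_third a b -> 0 < a < b -> classified a b.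
Proof.
  intros Hg Hab.
  apply (node_classified (Z.to_nat b) _ _ _ _ _ _ a b node_root); lia || assumption.
Qed.

(** * Every Markoff number occurs in the tree *)

(** Descent on the largest coordinate. For [x <= y <= z] the Vieta partner [z' = 3 x y - z]
    satisfies [(z - y) (y - z') = y^2 (3 x - 2) - x^2], which is positive when [y > 1], so [z' < y].
    One move [node_left] undoes the descent. *)
Lemma solution_node n : forall x y z,
  0 < x <= z -> 0 < y <= z -> 2 <= z <= Z.of_nat n ->
  x * x + y * y + z * z = 3 * x * y * z ->
  exists p1 p p2, markoff_node p1 x p z p2 y.
Proof.
  induction n as [|n IH]; intros x y z Hx Hy Hz E; [lia|].
  assert (Sorted : forall x y, 0 < x <= y -> y <= z ->
    x * x + y * y + z * z = 3 * x * y * z -> exists p1 p p2, markoff_node p1 x p z p2 y).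
  { clear x y Hx Hy E. intros x y Hxy Hyz E.
    assert (Ez : z * (3 * x * y - z) = x * x + y * y) by lia.
    assert (Hz' : 0 < 3 * x * y - z) by (clear - Ez Hz Hxy; nia).
    assert (F : (z - y) * (y - (3 * x * y - z)) = y * y * (3 * x - 2) - x * x) by lia.
    destruct (Z.eq_dec y 1) as [->|Hy1].
    - assert (x = 1) as -> by lia.
      assert (z = 2) as -> by (clear - E Hz; nia).
      exists 0, 1, 1. apply node_root.
    - assert (F' : 0 < y * y * (3 * x - 2) - x * x).
      { clear - Hxy Hy1. assert (1 * (y * y) <= (3 * x - 2) * (y * y)) by nia.
        destruct (Z.eq_dec x 1) as [->|]; nia. }
      rewrite <- F in F'. clear F.
      assert (z <> y) by (intros ->; rewrite Z.sub_diag in F'; lia).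
      apply Z.mul_pos_cancel_l in F'; [|lia].
      destruct (IH x (3 * x * y - z) y) as (p1 & p & p2 & HN); [lia|lia|lia|clear - E; nia|].
      exists p1, (3 * x * p - p2), p. apply node_left in HN.
      now replace (3 * x * y - (3 * x * y - z)) with z in HN by ring. }
  destruct (Z_le_gt_dec x y) as [H|H]; [apply Sorted; lia|].
  destruct (Sorted y x) as (p1 & p & p2 & HN); [lia|lia|lia|].
  exists (- p2), (- p), (- p1). now apply node_mirror.
Qed.

(** The number is placed at the left outer vertex, the one that [node_chain] keeps fixed. A middle
    vertex gets there by one move [node_right]. *)
Lemma markoff_node_exists m :
  markoff m -> exists p1 p q p2 q2, markoff_node p1 m p q p2 q2.
Proof.
  assert (Sorted : forall x y z, 0 < x <= z -> 0 < y <= z ->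
    x * x + y * y + z * z = 3 * x * y * z -> m = x \/ m = y \/ m = z ->
    exists p1 p q p2 q2, markoff_node p1 m p q p2 q2).
  { intros x y z Hx Hy E Hm.
    destruct (Z.eq_dec m 1) as [->|Hm1]; [exists 0, 1, 2, 1, 1; apply node_root|].
    destruct (solution_node (Z.to_nat z) x y z Hx Hy ltac:(lia) E) as (p1 & p & p2 & HN).
    destruct Hm as [->|[->| ->]].
    - now exists p1, p, z, p2, y.
    - exists (- p2), (- p), z, (- p1), x. now apply node_mirror.
    - exists p, (3 * y * p - p1), (3 * y * z - x), p2, y. now apply node_right. }
  intros (x & y & z & Hx & Hy & Hz & E & Hm).
  assert (z <= x /\ y <= x \/ z <= y /\ x <= y \/ x <= z /\ y <= z) as [H|[H|H]] by lia.
  - apply (Sorted y z x); lia.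
  - apply (Sorted x z y); lia.
  - apply (Sorted x y z); lia.
Qed.

(** * From the real-valued [Zval] to integer minima *)

Open Scope R_scope.

Lemma fold_Rmin_spec (l : list R) (x : R) :
  (forall y, In y (x :: l) -> fold_left Rmin l x <= y) /\ In (fold_left Rmin l x) (x :: l).
Proof.
  revert x; induction l as [|z l IH]; intros x; simpl.
  - split; [intros y [->|[]]; lra|now left].
  - destruct (IH (Rmin x z)) as [H1 H2]. split.
    + intros y Hy.
      assert (Hm : fold_left Rmin l (Rmin x z) <= Rmin x z) by (apply H1; now left).
      pose proof (Rmin_l x z). pose proof (Rmin_r x z).
      destruct Hy as [->|[->|Hy]]; [lra|lra|]. apply H1. now right.
    + destruct H2 as [H2|H2]; [|auto].
      rewrite <- H2. unfold Rmin. destruct (Rle_dec x z); auto.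
Qed.

Lemma min_range_le f n q : (1 <= q <= n)%nat -> min_range f n <= f q.
Proof.
  intros Hq. unfold min_range.
  apply (proj1 (fold_Rmin_spec (map f (seq 2 (n - 1))) (f 1%nat))).
  change (In (f q) (map f (1%nat :: seq 2 (n - 1)))).
  apply in_map. destruct (Nat.eq_dec q 1) as [->|]; [now left|].
  right. apply in_seq. lia.
Qed.

Lemma min_range_attained f n :
  (1 <= n)%nat -> exists q, (1 <= q <= n)%nat /\ min_range f n = f q.
Proof.
  intros Hn. unfold min_range.
  pose proof (proj2 (fold_Rmin_spec (map f (seq 2 (n - 1))) (f 1%nat))) as H.
  change (In (fold_left Rmin (map f (seq 2 (n - 1))) (f 1%nat))
            (map f (1%nat :: seq 2 (n - 1)))) in H.
  apply in_map_iff in H. destruct H as (q & E & Hq).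
  exists q; split; [|now symmetry].
  destruct Hq as [<-|Hq]; [lia|]. apply in_seq in Hq. lia.
Qed.

Lemma dist_nint_le x z : dist_nint x <= Rabs (x - IZR z).
Proof.
  unfold dist_nint.
  destruct (base_Int_part x) as [H1 H2].
  pose proof (Rmin_l (x - IZR (Int_part x)) (IZR (Int_part x) + 1 - x)).
  pose proof (Rmin_r (x - IZR (Int_part x)) (IZR (Int_part x) + 1 - x)).
  destruct (Z_le_gt_dec z (Int_part x)) as [Hz|Hz].
  - apply IZR_le in Hz. rewrite Rabs_right; lra.
  - assert (Hz' : (Int_part x + 1 <= z)%Z) by lia.
    apply IZR_le in Hz'. rewrite plus_IZR in Hz'. rewrite Rabs_left1; lra.
Qed.

Lemma dist_nint_attained x : exists z, dist_nint x = Rabs (x - IZR z).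
Proof.
  unfold dist_nint. destruct (base_Int_part x) as [H1 H2].
  unfold Rmin. destruct (Rle_dec _ _).
  - exists (Int_part x). rewrite Rabs_right; lra.
  - exists (Int_part x + 1)%Z. rewrite plus_IZR, Rabs_left1; lra.
Qed.

Lemma scaled_distance (q b : nat) (a z : Z) :
  (1 <= b)%nat ->
  INR q * Rabs (INR q * IZR a / INR b - IZR z) * INR b =
  IZR (Z.of_nat q * Z.abs (z * Z.of_nat b - a * Z.of_nat q)).
Proof.
  intros Hb. assert (Hb' : 0 < INR b) by (apply lt_0_INR; lia).
  rewrite mult_IZR, abs_IZR, minus_IZR, !mult_IZR, <- !INR_IZR_INZ.
  rewrite Rabs_minus_sym, Rmult_assoc. f_equal.
  rewrite <- (Rabs_right (INR b)) at 2 by lra.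
  rewrite <- Rabs_mult. f_equal. field. lra.
Qed.

Lemma Zval_le a b (x y : Z) :
  (0 < y < Z.of_nat b)%Z ->
  Zval a b * INR b <= IZR (y * Z.abs (x * Z.of_nat b - a * y)).
Proof.
  intros Hy. rewrite <- (Z2Nat.id y) by lia.
  rewrite <- scaled_distance by lia.
  apply Rmult_le_compat_r; [apply pos_INR|].
  unfold Zval. etransitivity; [apply (min_range_le _ _ (Z.to_nat y)); lia|].
  apply Rmult_le_compat_l; [apply pos_INR|apply dist_nint_le].
Qed.

Lemma Zval_attained a b :
  (2 <= b)%nat -> exists x y, (0 < y < Z.of_nat b)%Z /\
    Zval a b * INR b = IZR (y * Z.abs (x * Z.of_nat b - a * y)).
Proof.
  intros Hb. unfold Zval.
  destruct (min_range_attained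
    (fun q => INR q * dist_nint (INR q * IZR a / INR b)) (b - 1) ltac:(lia)) as (q & Hq & ->).
  destruct (dist_nint_attained (INR q * IZR a / INR b)) as [z ->].
  exists z, (Z.of_nat q). split; [lia|]. apply scaled_distance. lia.
Qed.

Lemma det_nonzero a b x y :
  Z.gcd a b = 1%Z -> (0 < y < b)%Z -> (x * b - a * y <> 0)%Z.
Proof.
  intros Hg Hy H.
  enough (b | y)%Z as Hd by (apply Z.divide_pos_le in Hd; lia).
  apply (Gauss b a y); [exists x; lia|].
  apply Zgcd_1_rel_prime. now rewrite Z.gcd_comm.
Qed.

(** The minimiser in [min_is] automatically has [y < b]: the choice [y = 1] gives the product
    [a mod b < b], so [r < k], while [y >= b] gives a product of at least [b]. *)
Lemma Zval_min_is a b r k :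
  (2 <= b)%nat -> Z.gcd a (Z.of_nat b) = 1%Z -> (0 < k)%Z ->
  min_is a (Z.of_nat b) r k -> Zval a b = IZR r / IZR k.
Proof.
  intros Hb Hg Hk [Hlow (x & y & Hy & Hn & E)].
  set (B := Z.of_nat b) in *.
  assert (HB : IZR B = INR b) by (unfold B; symmetry; apply INR_IZR_INZ).
  assert (Hb0 : 0 < INR b) by (apply lt_0_INR; lia).
  assert (Hk0 : 0 < IZR k) by now apply IZR_lt.
  assert (Hr : (r < k)%Z).
  { pose proof (Z.mod_pos_bound a B ltac:(lia)) as Hm.
    pose proof (Z.div_mod a B ltac:(lia)) as Hd.
    pose proof (det_nonzero a B (a / B) 1 Hg ltac:(lia)) as Hnz.
    specialize (Hlow (a / B)%Z 1%Z ltac:(lia) Hnz).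
    assert (r * B < k * B)%Z; [|nia].
    eapply Z.le_lt_trans; [exact Hlow|].
    apply Z.mul_lt_mono_pos_l; lia. }
  assert (Hyb : (0 < y < B)%Z).
  { split; [exact Hy|].
    assert (r * B < k * B)%Z by (clear - Hr Hb; nia).
    assert (k * y <= k * (y * Z.abs (x * B - a * y)))%Z
      by (apply Z.mul_le_mono_nonneg_l; [lia|clear - Hy Hn; nia]).
    apply (Z.mul_lt_mono_pos_l k); lia. }
  apply Rle_antisym; apply (Rmult_le_reg_r (INR b * IZR k)); try nra.
  - pose proof (Zval_le a b x y Hyb) as H. fold B in H.
    replace (IZR r / IZR k * (INR b * IZR k)) with (IZR (r * B))
      by (rewrite mult_IZR, HB; field; lra).
    rewrite E, mult_IZR. nra.
  - destruct (Zval_attained a b Hb) as (x' & y' & Hy' & E').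
    specialize (Hlow x' y' ltac:(lia) (det_nonzero _ _ _ _ Hg Hy')). fold B in E'.
    apply IZR_le in Hlow. rewrite (mult_IZR k), <- E', mult_IZR, HB in Hlow.
    replace (IZR r / IZR k * (INR b * IZR k)) with (IZR r * INR b) by (field; lra).
    nra.
Qed.

Lemma spectrum_near_root s :
  Zspectrum s -> 1 / 3 < s ->
  exists m r k, near_root m r k /\ s = IZR (m * r) / IZR k.
Proof.
  intros (a & b & Hb & Hg & ->) Hs.
  set (B := Z.of_nat b) in *.
  assert (HB : IZR B = INR b) by (unfold B; symmetry; apply INR_IZR_INZ).
  assert (Hb0 : 0 < INR b) by (apply lt_0_INR; lia).
  pose proof (Z.div_mod a B ltac:(lia)) as Hd.
  pose proof (Z.mod_pos_bound a B ltac:(lia)) as Hm.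
  pose proof (det_nonzero a B (a / B) 1 Hg ltac:(lia)) as Hnz.
  (* Shifting by the integer part [c] brings the fraction into the unit interval and turns [(x, y)]
     into [(x + c y, y)]. *)
  set (c := (a / B)%Z) in *. set (a' := (a mod B)%Z) in *. clearbody c a'.
  assert (Hgood : above_third a' B).
  { intros x y Hy Hn.
    destruct (Z_lt_ge_dec y B) as [H|H].
    - pose proof (Zval_le a b (x + c * y) y ltac:(lia)) as H1. fold B in H1.
      replace ((x + c * y) * B - a * y)%Z with (x * B - a' * y)%Z in H1 by (rewrite Hd; ring).
      apply lt_IZR. rewrite mult_IZR, HB. nra.
    (* For [y >= B] a nonzero determinant alone makes the product at least [B]. *)
    - clear - H Hy Hn. nia. }
  destruct (above_third_classified a' B Hgood ltac:(lia)) as (m & r & k & Hmr & Hmin).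
  exists m, r, k. split; [exact Hmr|].
  destruct Hmr as (_ & _ & Hk & _).
  apply Zval_min_is; [exact Hb|exact Hg|lia|]. fold B.
  destruct Hmin as [Hlow (x & y & Hy & Hn & E)].
  assert (T : forall x y, (x * B - a * y = (x - c * y) * B - a' * y)%Z)
    by (intros; rewrite Hd; ring).
  split.
  - intros x' y' Hy' Hn'. rewrite T in *. now apply Hlow.
  - exists (x + c * y)%Z, y. rewrite T. replace (x + c * y - c * y)%Z with x by ring. auto.
Qed.

(** * Distance of spectrum values to [markoff_value] *)

Lemma sqrt_pos_9 m : 1 <= m ->
  sqrt (9 * m ^ 2 - 4) * sqrt (9 * m ^ 2 - 4) = 9 * m ^ 2 - 4 /\
  0 <= sqrt (9 * m ^ 2 - 4) < 3 * m.
Proof.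
  intros Hm.
  assert (H : sqrt (9 * m ^ 2 - 4) * sqrt (9 * m ^ 2 - 4) = 9 * m ^ 2 - 4)
    by (apply sqrt_sqrt; nra).
  pose proof (sqrt_pos (9 * m ^ 2 - 4)). repeat split; [exact H|lra|nra].
Qed.

(** Let [t = r / k] and let [t0] be the small root of [t^2 - 3 m t + 1]. The polynomial factors as
    [(t - t0) (t + t0 - 3 m)], and its second factor has absolute value at least 1, as [t <= 1] and
    [t0 <= 2 / 3]. *)
Lemma markoff_value_close m r k :
  near_root m r k ->
  Rabs (IZR (m * r) / IZR k - markoff_value m) <=
  IZR m * IZR (Z.abs (r * r + k * k - 3 * m * r * k)) / (IZR k * IZR k).
Proof.
  intros (_ & Hm & [Hr Hrk] & _ & _).
  rewrite mult_IZR, abs_IZR, minus_IZR, plus_IZR, !mult_IZR.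
  assert (Hm' : 1 <= IZR m) by (apply IZR_le; lia).
  apply IZR_lt in Hr. apply IZR_le in Hrk.
  unfold markoff_value.
  destruct (sqrt_pos_9 _ Hm') as (HS & HS0 & HS1).
  set (S := sqrt (9 * IZR m ^ 2 - 4)) in *. clearbody S.
  set (M := IZR m) in *. set (K := IZR k) in *. set (Q := IZR r) in *. clearbody M K Q.
  set (t := Q / K). set (t0 := (3 * M - S) / 2).
  assert (E0 : 2 * M / (S + 3 * M) = M * t0).
  { unfold t0. apply (Rmult_eq_reg_r (2 * (S + 3 * M))); [|lra].
    field_simplify; [|lra]. nra. }
  assert (Ht0 : t0 <= 2 / 3).
  { unfold t0. nra. }
  assert (Ht : t <= 1) by (unfold t; apply (Rmult_le_reg_r K); [lra|]; field_simplify; lra).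
  assert (F : (t - t0) * (t + t0 - 3 * M) = (Q * Q + K * K - 3 * M * Q * K) / (K * K)).
  { replace ((t - t0) * (t + t0 - 3 * M)) with (t * t - 3 * M * t + (3 * M * t0 - t0 * t0)) by ring.
    replace (3 * M * t0 - t0 * t0) with 1 by (unfold t0; nra).
    unfold t. field. lra. }
  rewrite E0.
  replace (M * Q / K - M * t0) with (M * (t - t0)) by (unfold t; field; lra).
  rewrite Rabs_mult, (Rabs_right M) by lra.
  replace (IZR 3) with 3 by reflexivity.
  unfold Rdiv. rewrite Rmult_assoc. apply Rmult_le_compat_l; [lra|].
  rewrite <- (Rabs_right (/ (K * K))) by (apply Rle_ge, Rlt_le, Rinv_0_lt_compat; nra).
  rewrite <- Rabs_mult. unfold Rdiv in F. rewrite <- F, Rabs_mult.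
  rewrite <- (Rmult_1_r (Rabs (t - t0))) at 1.
  apply Rmult_le_compat_l; [apply Rabs_pos|]. rewrite Rabs_left; lra.
Qed.

Lemma markoff_value_le m : 1 <= IZR m -> markoff_value m <= 1 / 3 + 1 / IZR m.
Proof.
  intros Hm. unfold markoff_value.
  destruct (sqrt_pos_9 _ Hm) as (HS & HS0 & HS1).
  set (S := sqrt (9 * IZR m ^ 2 - 4)) in *. clearbody S. set (M := IZR m) in *. clearbody M.
  apply (Rmult_le_reg_r ((S + 3 * M) * (3 * M))); [nra|].
  replace (2 * M / (S + 3 * M) * ((S + 3 * M) * (3 * M))) with (6 * M * M) by (field; lra).
  replace ((1 / 3 + 1 / M) * ((S + 3 * M) * (3 * M))) with (M * (S + 3 * M) + 3 * (S + 3 * M))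
    by (field; lra).
  assert (3 * M - S <= 4 / 3) by nra.
  nra.
Qed.

(** The last clause of [near_root] makes the distance to [markoff_value m] at most [1 / m].
    Consequently only finitely many [m] occur above [1/3 + delta]. *)
Lemma near_root_le m r k :
  near_root m r k -> IZR (m * r) / IZR k <= 1 / 3 + 2 / IZR m.
Proof.
  intros H. pose proof (markoff_value_close _ _ _ H) as Hc.
  destruct H as (_ & Hm & [Hr Hrk] & _ & Hb).
  assert (Hm' : 1 <= IZR m) by (apply IZR_le; lia).
  pose proof (markoff_value_le m Hm') as Hv.
  apply IZR_le in Hb. rewrite !mult_IZR in Hb.
  assert (Hk : 0 < IZR k) by (apply IZR_lt; lia).
  set (c := IZR (Z.abs (r * r + k * k - 3 * m * r * k))) in *. clearbody c.
  assert (IZR m * c / (IZR k * IZR k) <= 1 / IZR m).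
  { apply (Rmult_le_reg_r (IZR k * IZR k * IZR m)); [nra|].
    field_simplify; nra. }
  pose proof (Rle_abs (IZR (m * r) / IZR k - markoff_value m)).
  lra.
Qed.

(** * Limit points *)

Lemma list_gap (x : R) (l : list R) :
  exists eps, 0 < eps /\ forall s, In s l -> s <> x -> eps <= Rabs (s - x).
Proof.
  induction l as [|z l (e & He & IH)]; [exists 1; split; [lra|intros s []]|].
  destruct (Req_dec z x) as [->|Hz].
  - exists e; split; [exact He|]. intros s [->|Hs] Hn; [now contradict Hn|auto].
  - assert (0 < Rabs (z - x)) by (apply Rabs_pos_lt; lra).
    exists (Rmin e (Rabs (z - x))). split; [now apply Rmin_glb_lt|].
    intros s [<-|Hs] Hn; [apply Rmin_r|].
    etransitivity; [apply Rmin_l|auto].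
Qed.

Lemma nat_upper (x : R) : exists n, x < IZR (Z.of_nat n).
Proof.
  destruct (archimed x) as [H _]. exists (Z.to_nat (up x)).
  eapply Rlt_le_trans; [exact H|apply IZR_le; lia].
Qed.

(** If [x] is no Markoff value, spectrum points near [x] have [m] bounded by [K], hence stay away
    from [markoff_value m], hence have bounded [k]. They form a finite set, which cannot accumulate
    at [x]. *)
Lemma limit_point_markoff x :
  limit_point Zspectrum x -> 1 / 3 < x -> exists m, markoff m /\ x = markoff_value m.
Proof.
  intros Hlim Hx. apply Classical_Prop.NNPP; intros Hno.
  set (delta := (x - 1 / 3) / 2).
  assert (Hdelta : 0 < delta) by (unfold delta; lra).
  destruct (nat_upper (2 / delta)) as [K HK].
  set (vals := map (fun i => markoff_value (Z.of_nat i)) (seq 0 (S K))).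
  destruct (list_gap x vals) as (eta & Heta & Hvals).
  (* The bound on [k] comes from [eta / 2 <= m^3 / k^2 <= K^3 / k^2]. *)
  destruct (nat_upper (2 * IZR (Z.of_nat K) ^ 3 / eta)) as [B HB].
  set (fracs := map (fun p => IZR (Z.of_nat (fst (fst p)) * Z.of_nat (snd (fst p))) /
                              IZR (Z.of_nat (snd p)))
    (list_prod (list_prod (seq 0 (S K)) (seq 0 (S B))) (seq 0 (S B)))).
  destruct (list_gap x fracs) as (eps & Heps & Hfracs).
  destruct (Hlim (Rmin eps (Rmin (eta / 2) delta))) as (s & Hs & Hsx & Hclose).
  { repeat apply Rmin_glb_lt; lra. }
  pose proof (Rmin_l eps (Rmin (eta / 2) delta)) as M1.
  pose proof (Rmin_r eps (Rmin (eta / 2) delta)) as M2.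
  pose proof (Rmin_l (eta / 2) delta) as M3.
  pose proof (Rmin_r (eta / 2) delta) as M4.
  assert (Hs3 : 1 / 3 + delta < s).
  { assert (H : Rabs (s - x) < delta) by lra. apply Rabs_def2 in H. unfold delta in *. lra. }
  destruct (spectrum_near_root s Hs ltac:(lra)) as (m & r & k & Hmr & E).
  pose proof (near_root_le _ _ _ Hmr) as Hle. rewrite <- E in Hle.
  pose proof (markoff_value_close _ _ _ Hmr) as Hc. rewrite <- E in Hc.
  destruct Hmr as (Hmark & Hm & [Hr Hrk] & Hb & _).
  assert (Hm' : 1 <= IZR m) by (apply IZR_le; lia).
  assert (HmK : (m <= Z.of_nat K)%Z).
  { assert (delta < 2 / IZR m) by lra.
    assert (IZR m < 2 / delta).
    { apply (Rmult_lt_reg_r delta); [lra|].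
      replace (2 / delta * delta) with (2 / IZR m * IZR m) by (field; lra). nra. }
    apply Z.lt_le_incl, lt_IZR. lra. }
  assert (Hgap : eta <= Rabs (markoff_value m - x)).
  { apply Hvals; [|intros Heq; apply Hno; now exists m].
    apply in_map_iff. exists (Z.to_nat m). rewrite Z2Nat.id by lia.
    split; [reflexivity|]. apply in_seq. lia. }
  assert (Hdist : eta / 2 <= Rabs (s - markoff_value m)).
  { pose proof (Rabs_triang (markoff_value m - s) (s - x)) as H.
    replace (markoff_value m - s + (s - x)) with (markoff_value m - x) in H by ring.
    rewrite (Rabs_minus_sym (markoff_value m) s) in H. lra. }
  assert (HkB : (k <= Z.of_nat B)%Z).
  { assert (Hk1 : 1 <= IZR k) by (apply IZR_le; lia).
    apply IZR_le in Hb. rewrite mult_IZR in Hb. apply IZR_le in HmK.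
    set (c := IZR (Z.abs (r * r + k * k - 3 * m * r * k))) in *. clearbody c.
    assert (H : eta / 2 * (IZR k * IZR k) <= IZR m * c).
    { replace (IZR m * c) with (IZR m * c / (IZR k * IZR k) * (IZR k * IZR k)) by (field; lra).
      apply Rmult_le_compat_r; [nra|lra]. }
    assert (H' : IZR m * c <= IZR (Z.of_nat K) ^ 3).
    { apply Rle_trans with (IZR m ^ 3); [nra|]. apply pow_incr. lra. }
    assert (IZR k <= 2 * IZR (Z.of_nat K) ^ 3 / eta).
    { apply (Rmult_le_reg_r eta); [lra|].
      replace (2 * IZR (Z.of_nat K) ^ 3 / eta * eta) with (2 * IZR (Z.of_nat K) ^ 3)
        by (field; lra).
      assert (eta * IZR k <= eta * (IZR k * IZR k)) by (apply Rmult_le_compat_l; nra).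
      lra. }
    apply Z.lt_le_incl, lt_IZR. lra. }
  assert (Hin : In s fracs).
  { apply in_map_iff. exists ((Z.to_nat m, Z.to_nat r), Z.to_nat k). cbn [fst snd].
    rewrite !Z2Nat.id by lia. split; [now symmetry|].
    apply in_prod; [apply in_prod|]; apply in_seq; lia. }
  specialize (Hfracs s Hin Hsx). lra.
Qed.

Lemma node_spectrum p1 q1 p q p2 q2 :
  markoff_node p1 q1 p q p2 q2 -> Zspectrum (IZR (q1 * q2) / IZR q).
Proof.
  intros HN. exists p, (Z.to_nat q).
  pose proof (node_square _ _ _ _ _ _ HN) as [l Hl].
  pose proof (node_min _ _ _ _ _ _ p q HN) as Hmin.
  destruct HN as [P1 P2 L1 L2 _ _ _ _ _ _ _ _].
  assert (Hb : (2 <= Z.to_nat q)%nat) by lia.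
  assert (Hg : Z.gcd p (Z.of_nat (Z.to_nat q)) = 1%Z).
  { rewrite Z2Nat.id by lia. apply Zgcd_1_rel_prime, bezout_rel_prime.
    apply (Bezout_intro _ _ _ (- p) l). lia. }
  repeat split; [exact Hb|exact Hg|].
  symmetry. apply Zval_min_is; [exact Hb|exact Hg|lia|].
  rewrite Z2Nat.id by lia. apply Hmin; lia.
Qed.

Lemma markoff_limit_point m :
  markoff m -> limit_point (fun s => Zspectrum s /\ 1 / 3 < s) (markoff_value m).
Proof.
  intros Hm eps Heps.
  destruct (markoff_node_exists m Hm) as (p1 & p & q & p2 & q2 & HN).
  assert (Hgrow : forall k, (Z.of_nat k < lrec (3 * m) q2 q k)%Z).
  { induction k as [|k IH]; [apply HN|].
    pose proof (mn_lt2 _ _ _ _ _ _ (node_chain _ _ _ _ _ _ k HN)). lia. }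
  (* The first summand makes the error [m^3 / k^2] smaller than [eps]; the second ensures [m <= r]
     for [near_root_triple]. *)
  destruct (nat_upper (IZR m ^ 3 / eps + IZR m)) as [n Hup].
  pose proof (node_chain _ _ _ _ _ _ n HN) as HNn.
  pose proof (Hgrow n) as Hn.
  set (r := lrec (3 * m) q2 q n) in *. set (k := lrec (3 * m) q2 q (S n)) in *.
  clearbody r k.
  pose proof (node_spectrum _ _ _ _ _ _ HNn) as Hspec.
  destruct HNn as [P1 P2 L1 L2 E _ _ _ _ _ _ _].
  assert (Hm' : 1 <= IZR m) by (apply IZR_le; lia).
  assert (Hm3 : 0 < IZR m ^ 3 / eps).
  { apply Rdiv_lt_0_compat; [apply pow_lt; lra|exact Heps]. }
  assert (Hmn : (m < Z.of_nat n)%Z) by (apply lt_IZR; lra).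
  assert (Hnr : near_root m r k) by (apply near_root_triple; lia).
  exists (IZR (m * r) / IZR k).
  assert (Hk : 1 <= IZR k) by (apply IZR_le; lia).
  assert (Er : IZR r * IZR r + IZR k * IZR k - 3 * IZR m * IZR r * IZR k = - (IZR m * IZR m)).
  { rewrite <- !mult_IZR, <- plus_IZR, <- minus_IZR, <- opp_IZR. f_equal. lia. }
  repeat split.
  - exact Hspec.
  - apply (Rmult_lt_reg_r (3 * IZR k)); [lra|].
    replace (IZR (m * r) / IZR k * (3 * IZR k)) with (IZR (3 * m * r))
      by (rewrite !mult_IZR; field; lra).
    replace (1 / 3 * (3 * IZR k)) with (IZR k) by field.
    apply IZR_lt. nia.
  - (* an equality would make [r / k] a root of [t^2 - 3 m t + 1] *)
    intros Heq. unfold markoff_value in Heq.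
    destruct (sqrt_pos_9 _ Hm') as (HS & HS0 & HS1).
    set (S := sqrt (9 * IZR m ^ 2 - 4)) in *. clearbody S.
    rewrite mult_IZR in Heq. set (M := IZR m) in *. set (R := IZR r) in *.
    set (K := IZR k) in *. clearbody M R K.
    assert (Ht : R * (S + 3 * M) = 2 * K).
    { apply (Rmult_eq_reg_l (M / (K * (S + 3 * M)))).
      - transitivity (M * R / K); [field; lra|]. rewrite Heq. field; lra.
      - apply Rgt_not_eq, Rdiv_lt_0_compat; nra. }
    nra.
  - eapply Rle_lt_trans; [now apply markoff_value_close|].
    replace (r * r + k * k - 3 * m * r * k)%Z with (- (m * m))%Z by lia.
    rewrite Z.abs_opp, Z.abs_eq by nia. rewrite mult_IZR.
    apply (Rmult_lt_reg_r (IZR k * IZR k)); [nra|].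
    replace (IZR m * (IZR m * IZR m) / (IZR k * IZR k) * (IZR k * IZR k)) with
      (IZR m ^ 3 / eps * eps) by (field; lra).
    assert (HkI : IZR (Z.of_nat n) <= IZR k) by (apply IZR_le; lia).
    rewrite (Rmult_comm _ eps). apply Rmult_lt_compat_l; nra.
Qed.

Theorem theorem1 :
  (forall m : Z, markoff m ->
     limit_point (fun s => Zspectrum s /\ 1 / 3 < s) (markoff_value m)) /\
  (forall x : R, limit_point Zspectrum x -> 1 / 3 < x ->
     exists m : Z, markoff m /\ x = markoff_value m).
Proof. exact (conj markoff_limit_point limit_point_markoff). Qed.
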